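(* Let $G$ be a group and let $R$ be a $G$-graded commutative ring. The following statements are equivalent: (1) $R$ is a Gelfand $G$-graded ring; (2) $G\mathrm{Spec}(R)$, with the Zariski topology, is a normal space.
   Context: $G$ is a group with identity $e$. A commutative ring $R$ with unit is $G$-graded if $R=\bigoplus_{g\in G}R_g$ with additive subgroups $R_g$ satisfying $R_gR_{g'}\subseteq R_{gg'}$; $h(R)=\bigcup_{g\in G}R_g$ is the set of homogeneous elements. An ideal $I$ is graded if $I=\bigoplus_{g\in G}(I\cap R_g)$. A homogeneous prime ideal is a graded ideal $P\neq R$ such that for all $r,s\in h(R)$, $rs\in P$ implies $r\in P$ or $s\in P$; $G\mathrm{Spec}(R)$ is the set of these. A graded maximal ideal is a graded ideal that is maximal among proper graded ideals. The Zariski topology on $G\mathrm{Spec}(R)$ has as closed sets the sets $V_G(I)=\{P\in G\mathrm{Spec}(R) : I\subseteq P\}$, $I$ a graded ideal. $R$ is called a Gelfand ($G$-)graded ring if every homogeneous prime ideal of $R$ is contained in a unique graded maximal ideal of $R$. A topological space is normal if any two disjoint closed subsets have disjoint open neighborhoods (no $T_1$ or Hausdorff assumption is made). *)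

(* Defs.v *)
From HB Require Import structures.
From mathcomp Require Import all_boot all_order all_algebra.
From mathcomp Require Import boolp classical_sets functions cardinality fsbigop.
From mathcomp Require Import topology.

Set Implicit Arguments.
Unset Strict Implicit.
Unset Printing Implicit Defensive.

Import Order.TTheory GRing.Theory.
Local Open Scope classical_set_scope.
Local Open Scope ring_scope.

Section DirectSum.
Context {G : choiceType} {V : zmodType}.

Definition additive_subgroup (A : set V) : Prop :=
  A 0 /\ (forall x y, A x -> A y -> A (x - y)).

(* The finiteness condition is not redundant: [\sum_(g \in D) F g] is 0 by
   convention when [F] has infinite support in [D]. *)
Definition decomposition (A : G -> set V) (x : V) (f : G -> V) : Prop :=
  [/\ forall g, A g (f g),
      finite_set (f @^-1` [set~ 0])
    & x = \sum_(g \in [set: G]) f g].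

(* Internal direct sum: [M] is the direct sum of the family [A]. *)
Definition direct_sum (A : G -> set V) (M : set V) : Prop :=
  (forall x f, decomposition A x f -> M x) /\
  (forall x, M x -> exists! f, decomposition A x f).

End DirectSum.

(* The ring is a [comPzRingType], so that the zero ring is allowed; the group
   is written multiplicatively and need be neither finite nor abelian. *)
Record grading (G : groupType) (R : comPzRingType) := Grading {
  component :> G -> set R;
  component_subgroup : forall g, additive_subgroup (component g);
  component_direct_sum : direct_sum component [set: R];
  component_mul : forall g h x y,
    component g x -> component h y -> component (g * h)%g (x * y)
}.

Section GradedIdeals.
Context {G : groupType} {R : comPzRingType} (Rg : grading G R).

Definition homogeneous : set R := \bigcup_g Rg g.

Definition ideal (I : set R) : Prop :=
  [/\ I 0,
      forall x y, I x -> I y -> I (x + y)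
    & forall a x, I x -> I (a * x)].

Definition graded_ideal (I : set R) : Prop :=
  ideal I /\ direct_sum (fun g => I `&` Rg g) I.

Definition homogeneous_prime (P : set R) : Prop :=
  [/\ graded_ideal P,
      P <> [set: R]
    & forall r s, homogeneous r -> homogeneous s -> P (r * s) -> P r \/ P s].

Definition graded_maximal (M : set R) : Prop :=
  [/\ graded_ideal M,
      M <> [set: R]
    & forall J, graded_ideal J -> J <> [set: R] -> M `<=` J -> J = M].

Definition gelfand_graded : Prop :=
  forall P, homogeneous_prime P -> exists! M, graded_maximal M /\ P `<=` M.

End GradedIdeals.

Record gspec (G : groupType) (R : comPzRingType) (Rg : grading G R) := GSpec {
  gspec_ideal :> set R;
  gspec_prime : homogeneous_prime Rg gspec_ideal
}.

HB.instance Definition _ G R (Rg : grading G R) := gen_eqMixin (gspec Rg).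
HB.instance Definition _ G R (Rg : grading G R) := gen_choiceMixin (gspec Rg).

Definition VG (G : groupType) (R : comPzRingType) (Rg : grading G R)
  (I : set R) : set (gspec Rg) := [set P | I `<=` P].
Arguments VG {G R} Rg I.

Section GradedIdealsTheory.
Context {G : groupType} {R : comPzRingType} (Rg : grading G R).
Implicit Types (I J : set R) (F : set (set R)).

Lemma graded_idealP I : graded_ideal Rg I <->
  ideal I /\ (forall x f, I x -> decomposition Rg x f -> forall g, I (f g)).
Proof.
have [RgS RgU] := component_direct_sum Rg.
have weaken x f : decomposition (fun g => I `&` Rg g) x f ->
    decomposition Rg x f by case=> fI ffin ->; split=> // g; case: (fI g).
split=> [[idI [_ IU]]|[idI Ihom]]; split=> //.
  move=> x f Ix dxf g; have [f' [dxf' _]] := IU x Ix.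
  have [f0 [_ f0U]] := RgU x Logic.I.
  rewrite -(f0U _ dxf) (f0U _ (weaken _ _ dxf')).
  by case: dxf' => /(_ g)[].
split=> [x f [fI _ ->]|x Ix].
  case: idI => I0 ID _; apply: big_ind => // g _.
  by case: (fI g).
have [f [dxf fU]] := RgU x Logic.I; exists f; split.
  by case: (dxf) => fRg ffin ->; split=> // g; split=> //; exact: (Ihom x f).
by move=> f' /weaken; exact: fU.
Qed.

Lemma graded_idealT : graded_ideal Rg [set: R].
Proof. by apply/graded_idealP; split. Qed.

Lemma graded_ideal_bigcap F : (forall I, F I -> graded_ideal Rg I) ->
  graded_ideal Rg (\bigcap_(I in F) I).
Proof.
move=> FG; apply/graded_idealP; split.
  split=> [I /FG[[]//]|x y Fx Fy I FI|a x Fx I FI].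
  - by have [[_ ID _] _] := FG _ FI; apply: ID; [exact: Fx|exact: Fy].
  - by have [[_ _ IM] _] := FG _ FI; apply: IM; exact: Fx.
move=> x f Fx dxf g I FI; have /graded_idealP[_ Ihom] := FG _ FI.
by apply: (Ihom x f) => //; exact: Fx.
Qed.

Lemma graded_idealI I J : graded_ideal Rg I -> graded_ideal Rg J ->
  graded_ideal Rg (I `&` J).
Proof.
move=> gI gJ; rewrite -bigcap2inE (_ : \bigcap_(_ in _) _ =
  \bigcap_(K in [set I; J]) K); last first.
  rewrite bigcap2inE; apply/seteqP; split=> [x [Ix Jx] K [->|->]//|x H].
  by split; apply: H; [left|right].
by apply: graded_ideal_bigcap => K [->|->].
Qed.

Lemma VGT : VG Rg [set: R] = set0.
Proof.
by apply/seteqP; split=> // P /= TP; case: (gspec_prime P) => _ + _; case;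
  apply/seteqP.
Qed.

Lemma VGI I J : graded_ideal Rg I -> graded_ideal Rg J ->
  VG Rg (I `&` J) = VG Rg I `|` VG Rg J.
Proof.
move=> gI gJ; apply/seteqP; split=> [P IJP|P [IP|JP] x [Ix Jx]]; last 2 first.
- exact: IP.
- exact: JP.
have [/= gP _ Pprime] := gspec_prime P.
have [RgS RgU] := component_direct_sum Rg.
have hom K : graded_ideal Rg K -> ~ VG Rg K P ->
    exists2 r, homogeneous Rg r & K r /\ ~ gspec_ideal P r.
  move=> gK; apply: contra_notP => nK x Kx.
  have [f [dxf _]] := RgU x Logic.I; have /graded_idealP[_ Khom] := gK.
  case: gP => -[P0 PD _] _; have [fRg _ ->] := dxf.
  apply: big_ind => // g _; apply: contrapT => nPfg; apply: nK.
  by exists (f g); [exists g|split=> //; exact: (Khom x f)].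
apply: contrapT => /not_orP[nI nJ].
have [r hr [Ir nPr]] := hom _ gI nI; have [s hs [Js nPs]] := hom _ gJ nJ.
have [[_ _ IM] _] := gI; have [[_ _ JM] _] := gJ.
have /(Pprime _ _ hr hs)[] // : gspec_ideal P (r * s).
by apply: IJP; split; [rewrite mulrC; exact: IM|exact: JM].
Qed.

Definition zariski_open : set (set (gspec Rg)) :=
  [set U | exists2 I, graded_ideal Rg I & ~` U = VG Rg I].

Lemma zariski_openT : zariski_open setT.
Proof. by exists [set: R]; [exact: graded_idealT|rewrite VGT setCT]. Qed.

Lemma zariski_openI : setI_closed zariski_open.
Proof.
move=> A B [I gI AI] [J gJ BJ]; exists (I `&` J); first exact: graded_idealI.
by rewrite setCI AI BJ VGI.
Qed.

Lemma zariski_open_bigU (T : Type) (U : T -> set (gspec Rg)) :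
  (forall i, zariski_open (U i)) -> zariski_open (\bigcup_i U i).
Proof.
move=> oU; exists (\bigcap_(J in [set J | graded_ideal Rg J /\
    forall i I, ~` U i = VG Rg I -> I `<=` J]) J).
  by apply: graded_ideal_bigcap => J [].
rewrite setC_bigcup; apply/seteqP; split=> [P UP x Hx|P JP i _].
  apply: Hx; split; first by case: (gspec_prime P).
  by move=> i I UI; have := UP i Logic.I; rewrite UI.
have [I gI UI] := oU i; rewrite UI => x Ix; apply: JP => J [_ UJ].
exact: (UJ i I).
Qed.

End GradedIdealsTheory.

HB.instance Definition _ G R (Rg : grading G R) :=
  isOpenTopological.Build (gspec Rg) (zariski_openT Rg) (@zariski_openI _ _ Rg)
    (@zariski_open_bigU _ _ Rg).

Lemma gspec_closedP (G : groupType) (R : comPzRingType) (Rg : grading G R)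
    (A : set (gspec Rg)) :
  closed A <-> exists2 I, graded_ideal Rg I & A = VG Rg I.
Proof.
have openP (U : set (gspec Rg)) : open U <-> zariski_open U.
  rewrite openE /interior; split=> [oU|zU P UP]; last by exists U; split.
  pose T := {B : set (gspec Rg) | zariski_open B /\ B `<=` U}.
  have -> : U = \bigcup_(i : T) sval i.
    apply/seteqP; split=> [P /oU[B [zB BP BU]]|P [[B [/= _ BU]] _]].
      by exists (exist _ B (conj zB BU)).
    exact: BU.
  by apply: zariski_open_bigU => -[B []].
rewrite -openC openP; split=> [[I gI]|[I gI AI]].
  by rewrite setCK => AI; exists I.
by exists I; rewrite ?setCK.
Qed.

Lemma normal_space_openP (T : topologicalType) : normal_space T <->
  forall A B : set T, closed A -> closed B -> A `&` B = set0 ->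
  exists U V, [/\ open U, open V, A `<=` U, B `<=` V & U `&` V = set0].
Proof.
split=> [nT A B cA cB /disjoints_subset AB|sepT A cA B /set_nbhsP[C [oC AC CB]]].
  have : set_nbhs A (~` B).
    by apply/set_nbhsP; exists (~` B); split=> //; exact: closed_openC.
  move=> /(nT A cA)[W /set_nbhsP[U [oU AU UW]] WB].
  exists U, (~` closure W); split=> //.
  - exact/closed_openC/closed_closure.
  - by move=> x Bx Wx; exact: (WB x).
  - by apply/disjoints_subset; rewrite setCK => x /UW; exact: subset_closure.
have [|U [V [oU oV AU CV UV]]] := sepT A (~` C) cA (open_closedC oC).
  by apply/disjoints_subset; rewrite setCK.
exists U; first by apply/set_nbhsP; exists U; split.
have cV : closed (~` V) by exact: open_closedC.
apply: subset_trans CB; apply: (@subset_trans _ (~` V)).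
  by rewrite ((closure_id _).1 cV); apply: closureS; apply/disjoints_subset.
by rewrite -[C]setCK; exact: subsetC.
Qed.

(* Main.v *)
(* If the ring is Gelfand and M, M' are distinct graded maximal ideals, then
   the multiplicative set of all products a * b, with a and b homogeneous
   outside M and M' respectively, contains 0; otherwise a homogeneous prime
   avoiding it would lie in both M and M'.  Passing from pairs of maximal
   ideals to disjoint closed sets V(I), V(J) uses no compactness: for a
   multiplicative set S of homogeneous elements, the elements killed by some
   member of S form a graded ideal.  Applied to the complement of a maximal M
   containing I, and then to the elements of 1 + J of identity degree, this produces
   c in 1 + I and b in 1 + J homogeneous with c * b = 0, and the basic opens
   of c and b separate V(I) from V(J).
   Conversely, when a homogeneous prime P lies in two distinct graded maximal
   ideals M and M', these are closed points, and P belongs to every open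
   neighbourhood of M and of M'. *)

Require Import Defs.
From mathcomp Require Import all_boot all_order all_algebra.
From mathcomp Require Import boolp classical_sets topology.
From mathcomp Require Import cardinality fsbigop.

Set Implicit Arguments.
Unset Strict Implicit.
Unset Printing Implicit Defensive.

Import GRing.Theory.
Local Open Scope classical_set_scope.
Local Open Scope ring_scope.

(** * Homogeneous components of ring elements *)

Section HomogeneousComponents.
Context {G : groupType} {R : comPzRingType} (Rg : grading G R).
Implicit Types (x y a : R) (g h : G) (I J K P M S : set R).

Lemma exists_decomposition x : exists f, decomposition Rg x f.
Proof.
by have [_ /(_ x Logic.I)[f [fP _]]] := component_direct_sum Rg; exists f.
Qed.

Definition hcomp x : G -> R := projT1 (cid (exists_decomposition x)).

Lemma hcompP x : decomposition Rg x (hcomp x).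
Proof. exact: (projT2 (cid (exists_decomposition x))). Qed.

Lemma hcomp_in x g : Rg g (hcomp x g).
Proof. by case: (hcompP x). Qed.

Lemma hcomp_unique x f : decomposition Rg x f -> hcomp x = f.
Proof.
move=> xf; have [_ /(_ x Logic.I)[f0 [_ f0U]]] := component_direct_sum Rg.
by rewrite -(f0U _ xf) (f0U _ (hcompP x)).
Qed.

Lemma component0 g : Rg g 0.
Proof. by case: (component_subgroup Rg g). Qed.

Lemma componentB g x y : Rg g x -> Rg g y -> Rg g (x - y).
Proof. by case: (component_subgroup Rg g) => _; apply. Qed.

Lemma componentD g x y : Rg g x -> Rg g y -> Rg g (x + y).
Proof.
move=> gx gy; rewrite -[y]opprK -[- y]sub0r; apply: componentB => //.
by apply: componentB => //; exact: component0.
Qed.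

Lemma hcompD x y g : hcomp (x + y) g = hcomp x g + hcomp y g.
Proof.
rewrite (@hcomp_unique _ (fun g => hcomp x g + hcomp y g)) //.
have [fx finx ex] := hcompP x; have [fy finy ey] := hcompP y.
have supp (f : G -> R) (D : set G) : f @^-1` [set~ 0] `<=` D ->
    \sum_(k \in D) f k = \sum_(k \in [set: G]) f k.
  move=> fD; apply: fsbig_widen => // k [_ /= nDk].
  by apply: contrapT => fk; apply: nDk; exact: fD.
(* Finitely supported sums split additively over a finite index set. [D] is finite and contains the
   supports of both summands and of their sum, so all three sums may be taken over [D]. *)
pose D := hcomp x @^-1` [set~ 0] `|` hcomp y @^-1` [set~ 0].
have finD : finite_set D by rewrite finite_setU.
have subD : (fun k => hcomp x k + hcomp y k) @^-1` [set~ 0] `<=` D.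
  move=> k /= nk; apply: contrapT => /not_orP[/= /contrapT xk /contrapT yk].
  by apply: nk; rewrite xk yk addr0.
split=> [k||]; first exact: componentD.
  exact: sub_finite_set subD finD.
rewrite {1}ex {1}ey -(supp _ D subD) -(supp (hcomp x) D); last by move=> k; left.
by rewrite -(supp (hcomp y) D) ?fsbig_split//; move=> k; right.
Qed.

(** Left translation by [h] permutes [G], so the components of [x], shifted by [h] and multiplied by
    [a], form a decomposition of [a * x]. *)
Lemma hcompMl a x h g : Rg h a ->
  hcomp (a * x) g = a * hcomp x (h^-1 * g)%g.
Proof.
move=> ha; rewrite (@hcomp_unique _ (fun g => a * hcomp x (h^-1 * g)%g)) //.
have [fx finx ex] := hcompP x.
have bij : bijective (fun k : G => (h^-1 * k)%g).
  by exists (fun k => (h * k)%g) => k; rewrite /= ?mulVKg ?mulKg.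
split=> [k||].
- by rewrite -[X in Rg X](mulVKg h); exact: component_mul.
- have hk : injective (fun k : G => (h^-1 * k)%g) by exact: bij_inj.
  apply: (@sub_finite_set _ _
    ((fun k => (h * k)%g) @` (hcomp x @^-1` [set~ 0]))); last first.
    exact: finite_image.
  move=> k /= nk; exists (h^-1 * k)%g; rewrite ?mulVKg //= => xk.
  by apply: nk; rewrite xk mulr0.
- rewrite {1}ex full_fsbig_distrr ?setTI//.
  by rewrite (reindex_fsbigT (fun k : G => (h^-1 * k)%g)).
Qed.

Lemma hcomp_id x h : Rg h x -> hcomp x h = x.
Proof.
move=> hx; rewrite (@hcomp_unique _ (fun g => if g == h then x else 0)) ?eqxx//.
have suppS : (fun g => if g == h then x else 0) @^-1` [set~ 0] `<=` [set h].
  by move=> k /=; case: eqP.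
split=> [k||]; first by case: eqP => [->//|_]; exact: component0.
  exact: sub_finite_set suppS (finite_set1 _).
rewrite -(fsbig_widen [set h]) ?fsbig_set1 ?eqxx// => k [_ /= /eqP].
by move=> /negbTE ->.
Qed.

Lemma ideal_hcomp I x : ideal I -> (forall g, I (hcomp x g)) -> I x.
Proof.
case=> I0 ID _ Ix; have [_ _ ->] := hcompP x.
by apply: big_ind => // g _; exact: Ix.
Qed.

(** Comparing components of degree [g] in [y * 1 = y] shows that [u] fixes every homogeneous [y].
    The elements fixed by [u] form an ideal, so [u] fixes all of [R], in particular [1]. *)
Lemma one_identity_degree : Rg 1%g 1.
Proof.
set u := hcomp 1 1%g; suff -> : 1 = u by exact: hcomp_in.
suff E x : [set y | y * u = y] x by rewrite -[RHS]mul1r; exact/esym/E.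
apply: ideal_hcomp => [|g /=].
  split=> [|y z /= yu zu|a y /= yu]; first exact: mul0r.
    by rewrite mulrDl yu zu.
  by rewrite -mulrA yu.
have := hcompMl 1 g (hcomp_in x g).
by rewrite mulr1 mulVg hcomp_id//; exact: hcomp_in.
Qed.

Lemma homogeneous1 : homogeneous Rg 1.
Proof. by exists 1%g => //; exact: one_identity_degree. Qed.

Lemma homogeneousM x y :
  homogeneous Rg x -> homogeneous Rg y -> homogeneous Rg (x * y).
Proof.
by move=> [g _ gx] [h _ hy]; exists (g * h)%g => //; exact: component_mul.
Qed.

(** * Graded ideals: component criterion, sums, principal ideals *)

Lemma graded_ideal_hcompP I : graded_ideal Rg I <->
  ideal I /\ (forall x g, I x -> I (hcomp x g)).
Proof.
rewrite graded_idealP; split=> -[idI Ihom]; split=> // x; [move=> g Ix|move=> f Ix xf g].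
  exact: Ihom (hcompP x) g.
by rewrite -(hcomp_unique xf); exact: Ihom.
Qed.

Lemma ideal_eqT I : ideal I -> I 1 -> I = [set: R].
Proof.
by move=> [_ _ IM] I1; apply/seteqP; split=> // x _; rewrite -[x]mulr1; exact: IM.
Qed.

Lemma ideal_proper I : ideal I -> I <> [set: R] <-> ~ I 1.
Proof.
by move=> idI; split=> [IT /(ideal_eqT idI)//|I1 IT]; apply: I1; rewrite IT.
Qed.

Lemma graded_ideal_add I J : graded_ideal Rg I -> graded_ideal Rg J ->
  graded_ideal Rg [set x | exists i j, [/\ I i, J j & x = i + j]].
Proof.
move=> /graded_ideal_hcompP[[I0 ID IM] Ih] /graded_ideal_hcompP[[J0 JD JM] Jh].
apply/graded_ideal_hcompP; split; first split.
- by exists 0, 0; rewrite addr0.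
- move=> _ _ [i [j [Ii Jj ->]]] [k [l [Ik Jl ->]]].
  by exists (i + k), (j + l); rewrite addrACA; split; [exact: ID|exact: JD|].
- move=> a _ [i [j [Ii Jj ->]]]; exists (a * i), (a * j).
  by rewrite mulrDr; split; [exact: IM|exact: JM|].
- move=> _ g [i [j [Ii Jj ->]]]; exists (hcomp i g), (hcomp j g).
  by rewrite hcompD; split; [exact: Ih|exact: Jh|].
Qed.

Lemma graded_ideal_principal a : homogeneous Rg a ->
  graded_ideal Rg [set x | exists b, x = a * b].
Proof.
move=> [h _ ha]; apply/graded_ideal_hcompP; split; first split.
- by exists 0; rewrite mulr0.
- by move=> _ _ [b ->] [c ->]; exists (b + c); rewrite mulrDr.
- by move=> x _ [b ->]; exists (x * b); rewrite mulrCA.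
- by move=> _ g [b ->]; rewrite (hcompMl _ _ ha); eexists.
Qed.

Lemma graded_ideal0 : graded_ideal Rg [set 0].
Proof.
suff -> : [set 0] = [set x : R | exists b, x = 0 * b].
  by apply: graded_ideal_principal; exists 1%g => //; exact: component0.
apply/seteqP; split=> [_ ->|_ [b ->]]; first by exists 0; rewrite mul0r.
by rewrite mul0r.
Qed.

(** * Multiplicative sets of homogeneous elements and primes avoiding them *)

Definition homogeneous_mult S : Prop :=
  [/\ S 1, forall x y, S x -> S y -> S (x * y) & S `<=` homogeneous Rg].

(** A sum is killed by the product of two killers. If [s] has degree [h] and kills [x], then
    [s * hcomp x g] is the component of [s * x = 0] in degree [h * g], so the same [s] kills every
    component. *)
Lemma graded_ideal_killed S : homogeneous_mult S ->
  graded_ideal Rg [set x | exists2 s, S s & s * x = 0].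
Proof.
move=> [S1 SM Sh]; apply/graded_ideal_hcompP; split; first split.
- by exists 1; rewrite ?mulr0.
- move=> x y [s Ss sx] [t St ty]; exists (s * t); first exact: SM.
  by rewrite mulrDr mulrAC sx mul0r add0r -mulrA ty mulr0.
- by move=> a x [s Ss sx]; exists s; rewrite // mulrCA sx mulr0.
- move=> x g [s Ss sx]; exists s => //; have [h _ hs] := Sh _ Ss.
  rewrite -(mulKg h g) -(hcompMl _ _ hs) sx hcomp_id //; exact: component0.
Qed.

Lemma exists_maximal_avoiding I S : graded_ideal Rg I -> I `&` S = set0 ->
  exists P, [/\ graded_ideal Rg P, I `<=` P, P `&` S = set0 &
    forall J, graded_ideal Rg J -> J `&` S = set0 -> P `<=` J -> J = P].
Proof.
move=> gI IS.
pose good P := [/\ graded_ideal Rg P, I `<=` P & P `&` S = set0].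
(* [set0] is admitted because [Zorn_bigcup] also covers the empty chain. *)
have [|P [[P0|[gP IP PS]] Pmax]] :=
    @Zorn_bigcup _ [set P | P = set0 \/ good P].
- move=> F Fgood totF; have [[X FX gX]|nF] := pselect (exists2 X, F X & good X).
    have goodF x Y : F Y -> Y x -> good Y.
      by move=> FY Yx; have [Y0|//] := Fgood _ FY; rewrite Y0 in Yx.
    right; have [_ IX _] := gX; split.
    + apply/graded_ideal_hcompP; split; first split.
      * by exists X => //; apply: IX; case: gI => -[].
      * move=> x y [Y FY Yx] [Z FZ Zy].
        have [[idY _] _ _] := goodF _ _ FY Yx; have [_ YD _] := idY.
        have [[idZ _] _ _] := goodF _ _ FZ Zy; have [_ ZD _] := idZ.
        have [YZ|ZY] := totF _ _ FY FZ.
          by exists Z => //; apply: ZD => //; exact: YZ.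
        by exists Y => //; apply: YD => //; exact: ZY.
      * move=> a x [Y FY Yx]; exists Y => //.
        by have [[[_ _ YM] _] _ _] := goodF _ _ FY Yx; exact: YM.
      * move=> x g [Y FY Yx]; exists Y => //.
        by have [/graded_ideal_hcompP[_ Yh] _ _] := goodF _ _ FY Yx; exact: Yh.
    + by move=> x Ix; exists X => //; exact: IX.
    + apply/seteqP; split=> // x [[Y FY Yx] Sx].
      by have [_ _ <-] := goodF _ _ FY Yx.
  left; apply/seteqP; split=> // x [Y FY Yx].
  have [Y0|gY] := Fgood _ FY; first by rewrite Y0 in Yx.
  by case: nF; exists Y.
- exfalso; apply: (Pmax I); last by right; split.
  rewrite P0; split; first exact: sub0set.
  by move=> /(_ 0); apply; case: gI => -[].
- exists P; split=> // J gJ JS PJ; apply: contrapT => JP.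
  apply: (Pmax J); last by right; split=> // x /IP /PJ.
  by split=> // JP'; apply: JP; apply/seteqP.
Qed.

(** An ideal maximal among those avoiding [S] is prime: for homogeneous [r], [s] outside [P], both
    [P + (r)] and [P + (s)] meet [S], and if [r * s] were in [P], the product of the two elements
    found would lie in both [P] and [S]. *)
Lemma exists_prime_avoiding I S : graded_ideal Rg I -> homogeneous_mult S ->
  I `&` S = set0 ->
  exists P, [/\ homogeneous_prime Rg P, I `<=` P, P `&` S = set0 &
    forall J, graded_ideal Rg J -> J `&` S = set0 -> P `<=` J -> J = P].
Proof.
move=> gI [S1 SM Sh] IS.
have [P [gP IP PS Pmax]] := exists_maximal_avoiding gI IS.
have [idP _] := gP; have [P0 PD PM] := idP.
have nPS x : P x -> ~ S x by move=> Px Sx; rewrite -[False]/(set0 x) -PS.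
have meets r : homogeneous Rg r -> ~ P r -> exists p b, P p /\ S (p + r * b).
  move=> hr nPr; apply: contrapT => nS; apply: nPr.
  pose J := [set x | exists i j, [/\ P i, (exists b, j = r * b) & x = i + j]].
  suff <- : J = P.
    by exists 0, r; split=> //; [exists 1; rewrite mulr1|rewrite add0r].
  apply: Pmax.
  - exact: graded_ideal_add (graded_ideal_principal hr).
  - apply/seteqP; split=> // _ [[i [_ [Pi [b ->] ->]]] Sx].
    by apply: nS; exists i, b.
  - move=> x Px; exists x, 0; split; rewrite ?addr0//.
    by exists 0; rewrite mulr0.
exists P; split=> //; split=> //; first by apply/(ideal_proper idP) => /nPS.
move=> r s hr hs Prs; apply: contrapT => /not_orP[nPr nPs].
have [p [b [Pp Spb]]] := meets _ hr nPr; have [q [c [Pq Sqc]]] := meets _ hs nPs.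
(* Every term of the expanded product has a factor [p], [q] or [r * s], each in [P]. *)
apply: nPS (SM _ _ Spb Sqc); rewrite mulrDl; apply: (PD).
  by rewrite mulrC; exact: PM.
rewrite mulrDr; apply: PD; first exact: PM.
by rewrite mulrACA mulrC; exact: PM.
Qed.

Lemma homogeneous_mult1 : homogeneous_mult [set 1].
Proof.
by split=> // [x y -> ->|x ->]; [rewrite /= mulr1|exact: homogeneous1].
Qed.

(** An ideal avoids [[set 1]] exactly when it is proper, so maximality among avoiding ideals becomes
    graded maximality. *)
Lemma exists_graded_maximal I : graded_ideal Rg I -> ~ I 1 ->
  exists M, [/\ graded_maximal Rg M, homogeneous_prime Rg M & I `<=` M].
Proof.
have avoid1 J : ~ J 1 -> J `&` [set 1] = set0.
  by move=> J1; apply/seteqP; split=> // x [Jx x1]; apply: J1; rewrite -x1.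
move=> gI /avoid1 I1.
have [P [pP IP _ Pmax]] := exists_prime_avoiding gI homogeneous_mult1 I1.
exists P; split=> //; have [gP PT _] := pP; split=> // J gJ JT.
by apply: Pmax => //; apply: avoid1; apply/ideal_proper => //; case: gJ.
Qed.

Lemma graded_maximal_prime M : graded_maximal Rg M -> homogeneous_prime Rg M.
Proof.
move=> [gM MT Mmax]; have [idM _] := gM.
have [P [_ pP MP]] := exists_graded_maximal gM ((ideal_proper idM).1 MT).
by have [gP PT _] := pP; rewrite -(Mmax _ gP PT MP).
Qed.

Lemma homogeneous_mult_compl P : homogeneous_prime Rg P ->
  homogeneous_mult [set x | homogeneous Rg x /\ ~ P x].
Proof.
move=> [[idP _] PT Pp]; split=> [|x y [hx Px] [hy Py]|x []//].
  by split; [exact: homogeneous1|apply/ideal_proper].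
by split; [exact: homogeneousM|move=> /(Pp _ _ hx hy)[]].
Qed.

(** * From the Gelfand condition to separating elements *)

Lemma comaximal_identity_degree I J : graded_ideal Rg I -> graded_ideal Rg J ->
  (forall M, graded_maximal Rg M -> I `<=` M -> ~ J `<=` M) ->
  exists b, [/\ Rg 1%g b, I b & J (1 - b)].
Proof.
move=> gI gJ IJ.
have [i [j [Ii Jj e]]] : exists i j, [/\ I i, J j & 1 = i + j].
  apply: contrapT => n1.
  have [M [mM [[[M0 MD _] _] _ _] sM]] :=
    exists_graded_maximal (graded_ideal_add gI gJ) n1.
  have [[I0 _ _] _] := gI; have [[J0 _ _] _] := gJ.
  apply: (IJ M mM) => [x Ix|x Jx]; apply: sM.
    by exists x, 0; rewrite addr0.
  by exists 0, x; rewrite add0r.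
have /graded_ideal_hcompP[_ Ih] := gI; have /graded_ideal_hcompP[_ Jh] := gJ.
(* Since [1] has identity degree, the identity components of [i] and [j] still add up to [1]. *)
exists (hcomp i 1%g); split; [exact: hcomp_in|exact: Ih|].
by rewrite -{1}(hcomp_id one_identity_degree) e hcompD addrC addKr; exact: Jh.
Qed.

Lemma gelfand_separates_maximal M N : gelfand_graded Rg ->
  graded_maximal Rg M -> graded_maximal Rg N -> M <> N ->
  exists a b, [/\ homogeneous Rg a, homogeneous Rg b, ~ M a, ~ N b & a * b = 0].
Proof.
move=> gelf mM mN MN.
have [M1 MM Mh] := homogeneous_mult_compl (graded_maximal_prime mM).
have [N1 NM Nh] := homogeneous_mult_compl (graded_maximal_prime mN).
pose S := [set x | exists a b, [/\ homogeneous Rg a /\ ~ M a,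
  homogeneous Rg b /\ ~ N b & x = a * b]].
have Smult : homogeneous_mult S.
  split.
  - by exists 1, 1; rewrite mulr1.
  - move=> _ _ [a [b [Ma Nb ->]]] [c [d [Mc Nd ->]]].
    by exists (a * c), (b * d); rewrite mulrACA; split; [exact: MM|exact: NM|].
  - by move=> _ [a [b [[ha _] [hb _] ->]]]; exact: homogeneousM.
have [[a [b [[ha Ma] [hb Nb] ab]]]|nS] := pselect (S 0); first by exists a, b.
have S0 : [set 0] `&` S = set0 by apply/seteqP; split=> // _ [-> /nS].
have [P [pP _ PS _]] := exists_prime_avoiding graded_ideal0 Smult S0.
have nPS x : P x -> ~ S x by move=> Px Sx; rewrite -[False]/(set0 x) -PS.
have [/graded_ideal_hcompP[_ Ph] _ _] := pP.
have [K [_ KU]] := gelf P pP.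
(* Taking [1] as one of the two factors puts every homogeneous element outside [M] or outside [N]
   into [S]. As [P] avoids [S], its homogeneous elements lie in both [M] and [N]. *)
case: MN; rewrite -(KU M) ?(KU N) //; split=> // x Px.
- apply: ideal_hcomp => [|g]; first by case: mN => -[].
  apply: contrapT => nN; apply: (nPS (hcomp x g)); first exact: Ph.
  exists 1, (hcomp x g); rewrite mul1r; split=> //; split=> //.
  by exists g => //; exact: hcomp_in.
- apply: ideal_hcomp => [|g]; first by case: mM => -[].
  apply: contrapT => nM; apply: (nPS (hcomp x g)); first exact: Ph.
  exists (hcomp x g), 1; rewrite mulr1; split=> //; split=> //.
  by exists g => //; exact: hcomp_in.
Qed.

Lemma gelfand_separates_ideals I J : gelfand_graded Rg ->
  graded_ideal Rg I -> graded_ideal Rg J ->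
  (forall M, graded_maximal Rg M -> I `<=` M -> ~ J `<=` M) ->
  exists b c, [/\ Rg 1%g b /\ J (1 - b), Rg 1%g c /\ I (1 - c) & b * c = 0].
Proof.
move=> gelf gI gJ IJ.
pose T := [set b | Rg 1%g b /\ J (1 - b)].
have [[J0 JD JM] _] := gJ.
have Tmult : homogeneous_mult T.
  split=> [|b c [hb Jb] [hc Jc]|b [hb _]]; last by exists 1%g.
  - by split; [exact: one_identity_degree|rewrite subrr].
  - split; first by rewrite -[X in Rg X]mul1g; exact: component_mul.
    rewrite (_ : 1 - b * c = (1 - b) + b * (1 - c)); last first.
      by rewrite mulrBr mulr1 addrA subrK.
    by apply: JD => //; exact: JM.
have gL := graded_ideal_killed Tmult.
(* It suffices that no graded maximal ideal contains both [I] and the ideal killed by [T]: a [c] in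
   the latter brings along the [b] in [T] that kills it. *)
have [c [hc [b [hb Jb] bc] Ic]] : exists c, [/\ Rg 1%g c,
    [set x | exists2 s, T s & s * x = 0] c & I (1 - c)].
  apply: comaximal_identity_degree => // M mM LM IM.
  have Mmult := homogeneous_mult_compl (graded_maximal_prime mM).
  (* The [b] obtained here belongs to [T] and kills some [a] outside [M]; but then [a] is killed by
     [T], hence lies in [M]. *)
  have [|b [hb [a [ha nMa] ab] Jb]] :=
      comaximal_identity_degree (graded_ideal_killed Mmult) gJ.
    move=> N mN KN JN.
    have MN : M <> N by move=> MN; apply: (IJ M) => //; rewrite MN.
    have [a [b [ha hb nMa nNb ab]]] := gelfand_separates_maximal gelf mM mN MN.
    by apply: nNb; apply: KN; exists a.
  by apply: nMa; apply: LM; exists b; rewrite // mulrC.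
by exists b, c.
Qed.

(** * Separation in the graded spectrum *)

Lemma basic_open a : homogeneous Rg a -> open [set P : gspec Rg | ~ gspec_ideal P a].
Proof.
move=> ha; rewrite -closedC gspec_closedP.
exists [set x | exists b, x = a * b]; first exact: graded_ideal_principal.
apply/seteqP; split=> [P /= /contrapT Pa _ [b ->]|P /= aP].
  by have [[[_ _ PM] _] _ _] := gspec_prime P; rewrite mulrC; exact: PM.
by apply; apply: aP; exists 1; rewrite mulr1.
Qed.

Lemma gelfand_normal : gelfand_graded Rg -> normal_space (gspec Rg).
Proof.
move=> gelf; apply/normal_space_openP => A B.
move=> /gspec_closedP[I gI ->] /gspec_closedP[J gJ ->] IJ.
have [|b [c [[hb Jb] [hc Ic] bc]]] := gelfand_separates_ideals gelf gI gJ.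
  move=> M mM IM JM; rewrite -[False]/(set0 (GSpec (graded_maximal_prime mM))).
  by rewrite -IJ.
(* A prime containing both [1 - d] and [d] would contain [1]. *)
have notin K d (P : gspec Rg) : K (1 - d) -> VG Rg K P -> ~ gspec_ideal P d.
  move=> Kd KP Pd; have [[idP _] PT _] := gspec_prime P.
  have [_ PD _] := idP; apply: ((ideal_proper idP).1 PT).
  by rewrite -(subrK d 1); apply: PD => //; exact: KP.
exists [set P | ~ gspec_ideal P c], [set P | ~ gspec_ideal P b]; split.
- by apply: basic_open; exists 1%g.
- by apply: basic_open; exists 1%g.
- by move=> P; exact: notin.
- by move=> P; exact: notin.
- apply/seteqP; split=> // P [/= nPc nPb].
  have [[[P0 _ _] _] _ Pp] := gspec_prime P.
  by have [|||//|//] := Pp b c; [exists 1%g|exists 1%g|rewrite bc].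
Qed.

(** Closed sets have the form [VG Rg K], hence are stable under passing to larger primes; their
    complements are stable under passing to smaller ones. *)
Lemma open_generization (U : set (gspec Rg)) (P Q : gspec Rg) :
  open U -> P `<=` Q -> U Q -> U P.
Proof.
rewrite -closedC => /gspec_closedP[K _ UK] PQ UQ; apply: contrapT => nUP.
have KP : VG Rg K P by rewrite -UK.
suff : (~` U) Q by apply.
by rewrite UK => x Kx; apply: PQ; exact: KP.
Qed.

Lemma normal_gelfand : normal_space (gspec Rg) -> gelfand_graded Rg.
Proof.
move=> /normal_space_openP nor P pP; have [gP PT _] := pP; have [idP _] := gP.
have [M [mM pM PM]] := exists_graded_maximal gP ((ideal_proper idP).1 PT).
exists M; split=> // N [mN PN]; apply: contrapT => MN.
have pN := graded_maximal_prime mN.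
have [gM _ Mmax] := mM; have [gN _ Nmax] := mN.
have [|||U [V [oU oV MU NV UV]]] := nor (VG Rg M) (VG Rg N).
- by apply/gspec_closedP; exists M.
- by apply/gspec_closedP; exists N.
(* By maximality a prime containing [M] and [N] equals both. *)
- apply/seteqP; split=> // Q [MQ NQ]; have [gQ QT _] := gspec_prime Q.
  by apply: MN; rewrite -(Mmax _ gQ QT MQ) -(Nmax _ gQ QT NQ).
rewrite -[False]/(set0 (GSpec pP)) -UV; split.
- by apply: (@open_generization _ _ (GSpec pM)) => //; exact: MU.
- by apply: (@open_generization _ _ (GSpec pN)) => //; exact: NV.
Qed.

End HomogeneousComponents.

Theorem theorem2p11 (G : groupType) (R : comPzRingType) (Rg : grading G R) :
  gelfand_graded Rg <-> normal_space (gspec Rg).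
Proof. by split; [exact: gelfand_normal|exact: normal_gelfand]. Qed.
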